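(* Let $\dot A$ be a densely defined closed symmetric operator with deficiency indices $(1,1)$ in a Hilbert space $\mathcal H$, with $(+)$-normalized deficiency vectors $g_\pm\in\operatorname{Ker}(\dot A^*\mp iI)$. Let $\Theta$ be an L-system with symmetric operator $\dot A$, main operator $T\neq T^*$ (a maximal dissipative extension of $\dot A$) and quasi-kernel $\hat A$ of $\operatorname{Re}\mathbb A$, such that $g_+\in\operatorname{Dom}(T)$ (i.e. the von Neumann parameter of $T$ is $\kappa=0$) and either $g_+-g_-\in\operatorname{Dom}(\hat A)$ or $g_++g_-\in\operatorname{Dom}(\hat A)$. Then for every real $Q\neq 0$ the c-Entropy $\mathcal S(Q)$ of the perturbed L-system $\Theta(Q)$ is finite and $$\mathcal S(Q)=\tfrac12\ln(Q^2+4)-\ln|Q| .$$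
   Context: Rigged space: for a densely defined closed symmetric operator $\dot A$ in $\mathcal H$, let $\mathcal H_+=\operatorname{Dom}(\dot A^* )$ with inner product $(f,g)_+=(f,g)+(\dot A^*f,\dot A^*g)$, and let $\mathcal H_-$ be its dual, giving $\mathcal H_+\subset\mathcal H\subset\mathcal H_-$. $[\mathcal H_1,\mathcal H_2]$ denotes bounded linear operators from $\mathcal H_1$ to $\mathcal H_2$. If $\mathbb A\in[\mathcal H_+,\mathcal H_-]$ then $\mathbb A^*\in[\mathcal H_+,\mathcal H_-]$; put $\operatorname{Re}\mathbb A=\frac12(\mathbb A+\mathbb A^* )$, $\operatorname{Im}\mathbb A=\frac1{2i}(\mathbb A-\mathbb A^* )$. ''$(+)$-normalized'' means $\|g_\pm\|_+=1$ (note $\|g_\pm\|_+^2=2\|g_\pm\|^2$). An operator $T$ is dissipative if $\operatorname{Im}(Tf,f)\ge 0$ for all $f\in\operatorname{Dom}(T)$. $( * )$-extension: for $T$ with $\dot A\subset T\subset\dot A^*$, an operator $\mathbb A\in[\mathcal H_+,\mathcal H_-]$ is a $( * )$-extension of $T$ if $\dot A\subset T\subset\mathbb A$, $\dot A\subset T^*\subset\mathbb A^*$ and the quasi-kernel $\hat A$ of $\operatorname{Re}\mathbb A$, i.e. the restriction of $\operatorname{Re}\mathbb A$ to $\{f\in\mathcal H_+:(\operatorname{Re}\mathbb A)f\in\mathcal H\}$, is a self-adjoint extension of $\dot A$ in $\mathcal H$. L-system: given $\dot A$ with deficiency indices $(1,1)$ and a dissipative $T$ with $\dot A\subset T\subset\dot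 A^*$, an L-system $\Theta$ with symmetric operator $\dot A$ and main operator $T$ consists of the rigged space above, a $( * )$-extension $\mathbb A$ of $T$ (the state-space operator), and $K\in[\mathbb C,\mathcal H_-]$ with $K^*\in[\mathcal H_+,\mathbb C]$ and $\operatorname{Im}\mathbb A=KK^*$. Its transfer function is $W_\Theta(z)=I-2iK^*(\mathbb A-zI)^{-1}K$, $z\in\rho(T)$, and its impedance function is $V_\Theta(z)=K^*(\operatorname{Re}\mathbb A-zI)^{-1}K$; for $z\in\rho(T)$, $\operatorname{Im}z\ne0$, they are related by $V_\Theta(z)=i[W_\Theta(z)+I]^{-1}[W_\Theta(z)-I]$ and $W_\Theta(z)=(I+iV_\Theta(z))^{-1}(I-iV_\Theta(z))$. Von Neumann parameter: $\kappa$ with $|\kappa|<1$ is the von Neumann parameter of $T$ with respect to $g_\pm$ if $g_+-\kappa g_-\in\operatorname{Dom}(T)$. Perturbation: for $Q\in\mathbb R\setminus\{0\}$, the perturbed L-system $\Theta(Q)$ (the perturbation of $\Theta$) is an L-system with the same symmetric operator $\dot A$ as $\Theta$ whose impedance function satisfies the impedance shift formula $V_{\Theta(Q)}(z)=Q+V_\Theta(z)$. c-Entropy: the c-Entropy of an L-system $\Theta$ is $\mathcal S=-\ln|W_\Theta(-i)|$ (equal to $+\infty$ when $W_\Theta(-i)=0$). *)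

(* Defs.v *)
From HB Require Import structures.
From mathcomp Require Import all_boot all_order all_algebra sesquilinear.
From mathcomp Require Import all_classical all_reals all_analysis.
From mathcomp Require Import complex ring.

Set Implicit Arguments.
Unset Strict Implicit.
Unset Printing Implicit Defensive.

Import Order.TTheory GRing.Theory Num.Theory.
Import numFieldNormedType.Exports.
Local Open Scope classical_set_scope.
Local Open Scope complex_scope.
Local Open Scope ring_scope.

Local Notation ii := ('i%C).

Section DotNorm.
Context (C : numClosedFieldType) (U : lmodType C) (f : {dot U for (@Num.conj C)}).


Lemma dotZl a u v : f (a *: u) v = a * f u v.
Proof. by rewrite linearZl_LR. Qed.

Lemma dotZr a u v : f u (a *: v) = a^* * f u v.
Proof. by rewrite linearZr_LR. Qed.

Lemma dotDl u v w : f (u + v) w = f u w + f v w.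
Proof. by rewrite linearDl. Qed.

Lemma dotDr u v w : f u (v + w) = f u v + f u w.
Proof. by rewrite linearDr. Qed.

Lemma dotBl u v w : f (u - v) w = f u w - f v w.
Proof. by rewrite linearBl. Qed.

Lemma dotBr u v w : f u (v - w) = f u v - f u w.
Proof. by rewrite linearBr. Qed.

Lemma dotC u v : f u v = (f v u)^*.
Proof. by rewrite hermC expr0 mul1r. Qed.

Lemma dot_CauchySchwarz u v : `|f u v| ^+ 2 <= f u u * f v v.
Proof.
have [->|v0] := eqVneq v 0.
  by rewrite !linear0r normr0 expr0n.
have fv : 0 < f v v by rewrite dnorm_gt0.
have := dnorm_ge0 f (f v v *: u - f u v *: v).
have -> : f (f v v *: u - f u v *: v) (f v v *: u - f u v *: v)
   = f v v * (f u u * f v v - `|f u v| ^+ 2).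
  rewrite !(dotBl, dotBr) !dotZl !dotZr normCK.
  rewrite (geC0_conj (ltW fv)) (dotC v u).
  ring.
by rewrite pmulr_rge0// subr_ge0.
Qed.

Lemma sqrtC_dotD u v : sqrtC (f (u + v) (u + v)) <= sqrtC (f u u) + sqrtC (f v v).
Proof.
have su := sqrt_dnorm_ge0 f u; have sv := sqrt_dnorm_ge0 f v.
rewrite -(@ler_pXn2r _ 2) ?nnegrE ?sqrt_dnorm_ge0 ?addr_ge0//.
rewrite sqrtCK sqrrD !sqrtCK !(dotDl, dotDr) (dotC v u).
have := dot_CauchySchwarz u v.
rewrite -[f u u in X in _ <= X -> _]sqrtCK -[f v v in X in _ <= X -> _]sqrtCK.
rewrite -exprMn ler_pXn2r ?nnegrE ?mulr_ge0// => cs.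
have re : f u v + (f u v)^* <= `|f u v| *+ 2.
  rewrite (le_trans (real_ler_norm _))//; last first.
    by rewrite (le_trans (ler_normD _ _))// norm_conjC mulr2n.
  by rewrite CrealE rmorphD /= conjCK addrC.
have {}re : f u v + (f u v)^* <= (sqrtC (f u u) * sqrtC (f v v)) *+ 2.
  by rewrite (le_trans re)// lerMn2r cs orbT.
rewrite -subr_ge0 in re; rewrite -subr_ge0.
by apply: (le_trans re); rewrite le_eqVlt; apply/orP; left; apply/eqP; ring.
Qed.

Lemma sqrtC_dotZ a u : sqrtC (f (a *: u) (a *: u)) = `|a| * sqrtC (f u u).
Proof.
by rewrite dnormZ rootCMl ?exprn_ge0// sqrCK.
Qed.

End DotNorm.

(* Complex Hilbert spaces: a complete norm coming from an inner product that is
   linear in its first argument and conjugate-linear in the second one.  Norms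
   of normed modules over R[i] take (real, nonnegative) values in R[i]. *)
HB.mixin Record CompleteNormedModule_isHilbert (R : realType) (H : Type)
    of CompleteNormedModule R[i] H := {
  dotp : {dot H for (@Num.conj R[i])} ;
  dotpxx : forall x : H, dotp x x = `|x| ^+ 2 }.

#[short(type=hilbertType)]
HB.structure Definition Hilbert (R : realType) :=
  {H of CompleteNormedModule R[i] H & CompleteNormedModule_isHilbert R H}.

Lemma dotp_le (R : realType) (H : hilbertType R) (x y : H) :
  `|dotp x y| <= `|x| * `|y|.
Proof.
rewrite -(@ler_pXn2r _ 2) ?nnegrE ?mulr_ge0//.
by rewrite exprMn -!dotpxx dot_CauchySchwarz.
Qed.

(* [E, F] : bounded linear operators. *)
Record bounded_op (R : realType) (E F : normedModType R[i]) := BoundedOp {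
  bop_fun :> {linear E -> F} ;
  bop_bounded : exists M : R, forall x, `|bop_fun x| <= M%:C * `|x| }.

Section Antidual.
Context (R : realType) (E : normedModType R[i]).
Implicit Types phi : E -> R[i]^o.

Definition antidual_pred : {pred E -> R[i]^o} := fun phi =>
  `[< (forall (a : R[i]) (f g : E), phi (a *: f + g) = a^* * phi f + phi g) /\
      (exists M : R, forall f, `|phi f| <= M%:C * `|f|) >].

Fact antidual_submod : submod_closed antidual_pred.
Proof.
split=> [|a phi psi /asboolP[pl [M pM]] /asboolP[ql [N qN]]]; apply/asboolP.
  split=> [b f g|]; first by
    change (0 = b^* * 0 + 0 :> R[i]); rewrite mulr0 addr0.
  by exists 0 => f; change (`|0 : R[i]| <= 0%:C * `|f|); rewrite normr0 mul0r.
split=> [b f g|]; first by rewrite !fctE pl ql /GRing.scale/=; ring.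
exists (complex.Re `|a| * M + N) => f; rewrite !fctE (le_trans (ler_normD _ _))//.
have -> : (complex.Re `|a| * M + N)%:C = `|a| * M%:C + N%:C.
  by rewrite -[in RHS](RRe_real (normr_real a)) -rmorphM -rmorphD.
rewrite mulrDl lerD//.
by rewrite /GRing.scale/= normrM -mulrA ler_wpM2l.
Qed.
HB.instance Definition _ := GRing.isSubmodClosed.Build R[i] (E -> R[i]^o)
  antidual_pred antidual_submod.

(* The dual of E, consisting of bounded conjugate-linear functionals, so that
   a Hilbert space embeds linearly in it. *)
Record antidual := Antidual {
  antidual_fun :> E -> R[i]^o ;
  antidualP : antidual_fun \in antidual_pred }.
HB.instance Definition _ := [isSub for antidual_fun].
HB.instance Definition _ := [Choice of antidual by <:].
HB.instance Definition _ := [SubChoice_isSubLmodule of antidual by <:].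

Definition dual_norm (phi : antidual) : R[i] :=
  (sup [set complex.Re `|phi f| | f in [set f : E | `|f| <= 1]])%:C.


Lemma antidual_linear (phi : antidual) (a : R[i]) (f g : E) :
  phi (a *: f + g) = a^* * phi f + phi g.
Proof. by case: phi => p /= /asboolP[]. Qed.

Lemma antidual0 (phi : antidual) : phi 0 = 0.
Proof.
have := antidual_linear phi (-1) 0 0.
by rewrite scaler0 addr0 rmorphN1 mulN1r addNr.
Qed.

Lemma antidualZ (phi : antidual) (a : R[i]) (f : E) : phi (a *: f) = a^* * phi f.
Proof. by rewrite -[a *: f]addr0 antidual_linear antidual0 addr0. Qed.

Lemma antidual_addE (phi psi : antidual) f : (phi + psi) f = phi f + psi f.
Proof. by []. Qed.

Lemma antidual_scaleE (a : R[i]) (phi : antidual) f : (a *: phi) f = a * phi f.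
Proof. by []. Qed.

Lemma antidual_eq (phi psi : antidual) : (forall f, phi f = psi f) -> phi = psi.
Proof. by move=> e; apply: val_inj; apply: funext. Qed.

Lemma dual_norm_le (phi : antidual) (M : R) :
  (forall f : E, `|f| <= 1 -> `|phi f| <= M%:C) -> dual_norm phi <= M%:C.
Proof.
move=> pM; rewrite lecR; apply: ge_sup.
  by exists (complex.Re `|phi 0|); exists 0 => //=; rewrite normr0.
by move=> _ [f f1 <-]; rewrite -lecR RRe_real ?normr_real//; exact: pM.
Qed.

Fact dual_norm_has_ub (phi : antidual) :
  has_ubound [set complex.Re `|phi f| | f in [set f : E | `|f| <= 1]].
Proof.
have /asboolP[_ [M pM]] := antidualP phi.
exists `|M| => _ [g g1 <-]; rewrite -lecR RRe_real ?normr_real//.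
rewrite (le_trans (pM g))// (@le_trans _ _ (`|M|%:C * `|g|))//.
  by rewrite ler_wpM2r// lecR ler_norm.
by rewrite ler_piMr// ler0c.
Qed.

Lemma le_dual_norm (phi : antidual) f : `|phi f| <= dual_norm phi * `|f|.
Proof.
have [->|f0] := eqVneq f 0; first by rewrite antidual0 !normr0 mulr0.
have f0' : 0 < `|f| by rewrite normr_gt0.
rewrite -ler_pdivrMr// -[X in X <= _]RRe_real; last first.
  by rewrite rpredM ?rpredV ?normr_real.
rewrite lecR; apply: ub_le_sup; first exact: dual_norm_has_ub.
exists (`|f|^-1 *: f).
  by rewrite /= normrZ normfV normr_id mulVf// gt_eqF.
by rewrite antidualZ normrM norm_conjC normfV normr_id mulrC.
Qed.

Lemma dual_norm_ge0 (phi : antidual) : 0 <= dual_norm phi.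
Proof.
rewrite ler0c; apply: ub_le_sup; first exact: dual_norm_has_ub.
by exists 0; [rewrite /= normr0 | rewrite antidual0 normr0].
Qed.

Lemma dual_norm_bound (phi : antidual) (M : R[i]) : 0 <= M ->
  (forall f : E, `|phi f| <= M * `|f|) -> dual_norm phi <= M.
Proof.
move=> M0 pM; rewrite -[M]RRe_real ?ger0_real//; apply: dual_norm_le => f f1.
by rewrite RRe_real ?ger0_real// (le_trans (pM f))// ler_piMr.
Qed.

Fact dual_norm_triangle (phi psi : antidual) :
  dual_norm (phi + psi) <= dual_norm phi + dual_norm psi.
Proof.
apply: dual_norm_bound => [|f]; first by rewrite addr_ge0 ?dual_norm_ge0.
rewrite antidual_addE (le_trans (ler_normD _ _))// mulrDl.
by rewrite lerD ?le_dual_norm.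
Qed.

Fact dual_norm_eq0 (phi : antidual) : dual_norm phi = 0 -> phi = 0.
Proof.
move=> p0; apply: antidual_eq => f.
have := le_dual_norm phi f; rewrite p0 mul0r normr_le0 => /eqP ->.
by [].
Qed.

Fact dual_normZ (a : R[i]) (phi : antidual) : dual_norm (a *: phi) = `|a| * dual_norm phi.
Proof.
have le b psi : dual_norm (b *: psi) <= `|b| * dual_norm psi.
  apply: dual_norm_bound => [|f]; first by rewrite mulr_ge0 ?dual_norm_ge0.
  by rewrite antidual_scaleE normrM -mulrA ler_wpM2l ?le_dual_norm.
apply/eqP; rewrite eq_le le /=.
have [->|a0] := eqVneq a 0; first by rewrite normr0 mul0r dual_norm_ge0.
have a0' : 0 < `|a| by rewrite normr_gt0.
rewrite -ler_pdivlMl// -[phi in X in X <= _]scale1r -(mulVf a0) -scalerA.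
by rewrite (le_trans (le _ _))// normfV.
Qed.

HB.instance Definition _ := Lmodule_isNormed.Build R[i] antidual
  dual_norm_triangle dual_normZ dual_norm_eq0.

End Antidual.

Section Operators.
Context (R : realType) (H : hilbertType R).
Implicit Types (T S : set (H * H)) (f g h : H) (z : R[i]).

(* A (possibly unbounded) linear operator in H is given by its graph; inclusion
   of graphs is extension of operators. *)
Definition dom T : set H := [set f | exists h, T (f, h)].

Definition is_operator T : Prop :=
  [/\ T (0, 0),
      forall (a : R[i]) (p q : H * H), T p -> T q -> T (a *: p + q)
    & forall f h h', T (f, h) -> T (f, h') -> h = h'].

Definition adjoint T : set (H * H) :=
  [set p | forall q, T q -> dotp q.2 p.1 = dotp q.1 p.2].

Definition self_adjoint T : Prop := adjoint T = T.

Definition dissipative T : Prop :=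
  forall f h, T (f, h) -> 0 <= complex.Im (dotp h f).

Definition maximal_dissipative T : Prop :=
  dissipative T /\
  (forall S, is_operator S -> dissipative S -> T `<=` S -> S = T).

(* Ker (A^* - z I) *)
Definition deficiency_space T z : set H := [set f | adjoint T (f, z *: f)].

Definition one_dimensional (E : set H) : Prop :=
  exists2 e, e != 0 & E = [set a *: e | a in [set: R[i]]].

End Operators.

Record closed_symmetric (R : realType) (H : hilbertType R) := ClosedSymmetric {
  sym_graph :> set (H * H) ;
  sym_operator : is_operator sym_graph ;
  sym_dense : dense (dom sym_graph) ;
  sym_closed : closed sym_graph ;
  sym_symmetric : sym_graph `<=` adjoint sym_graph }.

Definition deficiency_indices_1_1 (R : realType) (H : hilbertType R)
    (A : closed_symmetric H) : Prop :=
  one_dimensional (deficiency_space A ii) /\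
  one_dimensional (deficiency_space A (- ii)).

Section Rigged.
Context (R : realType) (H : hilbertType R) (A : closed_symmetric H).

Definition Hplus_pred : {pred H} := fun f => `[< dom (adjoint A) f >].

Lemma adjoint_linear (a : R[i]) (p q : H * H) :
  adjoint A p -> adjoint A q -> adjoint A (a *: p + q).
Proof.
by move=> Ap Aq r Ar; rewrite /= !(dotDr, dotZr) (Ap _ Ar) (Aq _ Ar).
Qed.

Lemma adjoint_functional f h h' :
  adjoint A (f, h) -> adjoint A (f, h') -> h = h'.
Proof.
move=> Ah Ah'; apply/eqP; rewrite -subr_eq0; apply/negPn/negP => k0.
set k := h - h' in k0.
have nk : 0 < `|k| by rewrite normr_gt0.
have [] := @sym_dense _ _ A (ball k `|k|).
- by exists k; exact: ballxx.
- exact: ball_open.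
move=> x [bx [y Axy]]; have xk : dotp x k = 0.
  by rewrite dotBr -(Ah _ Axy) -(Ah' _ Axy) subrr.
have : `|k| ^+ 2 < `|k| ^+ 2; last by rewrite ltxx.
rewrite -{1}dotpxx -[dotp k k]subr0 -xk -dotBl.
rewrite -[X in X < _]ger0_norm; last first.
  by rewrite dotBl xk subr0 dnorm_ge0.
rewrite (le_lt_trans (dotp_le _ _))// expr2 ltr_pM2r//.
by move: bx; rewrite -ball_normE.
Qed.

Fact Hplus_submod : submod_closed Hplus_pred.
Proof.
split=> [|a f g /asboolP[h fh] /asboolP[k gk]]; apply/asboolP.
  by exists 0 => q _; rewrite /= !linear0r.
by exists (a *: h + k); exact: (adjoint_linear a fh gk).
Qed.
HB.instance Definition _ := GRing.isSubmodClosed.Build R[i] H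
  Hplus_pred Hplus_submod.

(* The space Dom A^*, with its graph inner product. *)
Record Hplus := MkHplus { Hplus_val :> H ; HplusP : Hplus_val \in Hplus_pred }.
HB.instance Definition _ := [isSub for Hplus_val].
HB.instance Definition _ := [Choice of Hplus by <:].
HB.instance Definition _ := [SubChoice_isSubLmodule of Hplus by <:].

Definition adj_op (f : Hplus) : H := sval (cid (asboolP _ (HplusP f))).

Lemma adj_opP (f : Hplus) : adjoint A (f : H, adj_op f).
Proof. by rewrite /adj_op; case: cid. Qed.

Lemma adj_op_linear (a : R[i]) (f g : Hplus) :
  adj_op (a *: f + g) = a *: adj_op f + adj_op g.
Proof.
exact: (adjoint_functional (adj_opP (a *: f + g))
  (adjoint_linear a (adj_opP f) (adj_opP g))).
Qed.

Definition dotp_plus (f g : Hplus) : R[i] :=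
  dotp (f : H) (g : H) + dotp (adj_op f) (adj_op g).

Fact dotp_plus_bilinear :
  bilinear_for *%R (@Num.conj R[i] \; *%R) dotp_plus.
Proof.
split=> u a f g; rewrite /dotp_plus adj_op_linear.
  by rewrite !(dotDl, dotZl) /=; ring.
by rewrite !(dotDr, dotZr) /=; ring.
Qed.
HB.instance Definition _ := bilinear_isBilinear.Build R[i] Hplus Hplus R[i]
  *%R (@Num.conj R[i] \; *%R) dotp_plus dotp_plus_bilinear.

Fact dotp_plus_hermitian (f g : Hplus) :
  dotp_plus f g = (-1) ^+ false * (dotp_plus g f)^*.
Proof.
by rewrite expr0 mul1r /dotp_plus rmorphD /= -!dotC.
Qed.
HB.instance Definition _ := isHermitianSesquilinear.Build R[i] Hplus false
  (@Num.conj R[i]) dotp_plus dotp_plus_hermitian.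

Fact dotp_plus_gt0 (f : Hplus) : f != 0 -> 0 < dotp_plus f f.
Proof.
move=> f0; rewrite /dotp_plus ltr_pwDl// ?dnorm_ge0// dnorm_gt0.
by apply: contra_neq f0 => f0; exact: val_inj.
Qed.
HB.instance Definition _ := isDotProduct.Build R[i] Hplus dotp_plus
  dotp_plus_gt0.

Definition plus_norm (f : Hplus) : R[i] := sqrtC (dotp_plus f f).

Fact plus_norm_eq0 (f : Hplus) : plus_norm f = 0 -> f = 0.
Proof. by move/eqP; rewrite sqrt_dnorm_eq0 => /eqP. Qed.

HB.instance Definition _ := Lmodule_isNormed.Build R[i] Hplus
  (@sqrtC_dotD _ _ dotp_plus) (@sqrtC_dotZ _ _ dotp_plus) plus_norm_eq0.


Lemma plus_norm_ge (f : Hplus) : `|f : H| <= `|f|.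
Proof.
rewrite -(@ler_pXn2r _ 2) ?nnegrE// [`|f|]/(plus_norm f) sqrtCK -dotpxx.
by rewrite lerDl dnorm_ge0.
Qed.

Definition Hminus := antidual Hplus.

(* The pairing (phi, f) between H_- and H_+ is the value [phi f], and
   h : H is identified with the functional (h, .). *)
Definition emb_fun (h : H) : Hplus -> R[i]^o := fun g => dotp h (g : H).

Fact emb_subproof (h : H) : emb_fun h \in antidual_pred (E := Hplus).
Proof.
apply/asboolP; split=> [a f g|]; first by rewrite /emb_fun dotDr dotZr.
exists (complex.Re `|h|) => f; rewrite RRe_real ?normr_real//.
by rewrite (le_trans (dotp_le _ _))// ler_wpM2l// plus_norm_ge.
Qed.

Definition emb (h : H) : Hminus := Antidual (emb_subproof h).

(* (B^* f, g) is the complex conjugate of (B g, f). *)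
Section StateAdjoint.
Context (B : bounded_op Hplus Hminus).

Definition bop_adj_form (f : Hplus) : Hplus -> R[i]^o := fun g => (B g f)^*.

Fact bop_adj_subproof f : bop_adj_form f \in antidual_pred (E := Hplus).
Proof.
have [M BM] := bop_bounded B.
apply/asboolP; split=> [a g h|]; rewrite /bop_adj_form.
  by rewrite linearP antidual_addE antidual_scaleE rmorphD rmorphM.
exists (M * complex.Re `|f|) => g.
have -> : (M * complex.Re `|f|)%:C = M%:C * `|f|.
  by rewrite -[in RHS](RRe_real (normr_real f)) -rmorphM.
rewrite norm_conjC.
rewrite mulrAC (le_trans (le_dual_norm _ _))// ler_wpM2r//.
exact: BM.
Qed.

Definition bop_adj_val f : Hminus := Antidual (bop_adj_subproof f).

Fact bop_adj_linear : linear bop_adj_val.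
Proof.
move=> a f g; apply: antidual_eq => h.
rewrite antidual_addE antidual_scaleE /= /bop_adj_form antidual_linear.
by rewrite rmorphD rmorphM /= conjCK.
Qed.
HB.instance Definition _ := GRing.isLinear.Build R[i] Hplus Hminus *:%R
  bop_adj_val bop_adj_linear.

Fact bop_adj_bounded : exists M : R, forall f, `|bop_adj_val f| <= M%:C * `|f|.
Proof.
have [M BM] := bop_bounded B; exists `|M| => f.
apply: dual_norm_bound => [|g]; first by rewrite mulr_ge0// ler0c.
rewrite norm_conjC (le_trans (le_dual_norm _ _))// mulrAC ler_wpM2r//.
by rewrite (le_trans (BM g))// ler_wpM2r// lecR ler_norm.
Qed.

Definition bop_adj : bounded_op Hplus Hminus := BoundedOp bop_adj_bounded.

Definition bop_Re (f : Hplus) : Hminus := 2^-1 *: (B f + bop_adj f).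
Definition bop_Im (f : Hplus) : Hminus := (2 * ii)^-1 *: (B f - bop_adj f).

End StateAdjoint.

(* K^* c is determined by (K c, f) = c (K^* f)^*. *)
Section ChannelAdjoint.
Context (K : bounded_op R[i]^o Hminus).

Definition channel_adj_val (f : Hplus) : R[i]^o := (K 1 f)^*.

Lemma channel_adjP (c : R[i]) (f : Hplus) : K c f = c * (channel_adj_val f)^*.
Proof.
rewrite /channel_adj_val conjCK -antidual_scaleE -linearZ.
by congr (K _ f); rewrite /GRing.scale/= mulr1.
Qed.

Fact channel_adj_linear : linear channel_adj_val.
Proof.
move=> a f g; rewrite /channel_adj_val antidual_linear rmorphD rmorphM /=.
by rewrite conjCK.
Qed.
HB.instance Definition _ := GRing.isLinear.Build R[i] Hplus R[i]^o *:%R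
  channel_adj_val channel_adj_linear.

Fact channel_adj_bounded :
  exists M : R, forall f, `|channel_adj_val f| <= M%:C * `|f|.
Proof.
exists (complex.Re (dual_norm (K 1))) => f.
by rewrite norm_conjC RRe_real ?ger0_real ?dual_norm_ge0// le_dual_norm.
Qed.

Definition channel_adj : bounded_op Hplus R[i]^o :=
  BoundedOp channel_adj_bounded.

End ChannelAdjoint.

(* The restriction of B : H_+ -> H_- to {f | B f \in H}, as an operator in H;
   an operator T in H satisfies T \subset B iff T is contained in it. *)
Definition part_in_H (B : Hplus -> Hminus) : set (H * H) :=
  [set p | exists2 f : Hplus, (f : H) = p.1 & B f = emb p.2].

Definition quasi_kernel (B : bounded_op Hplus Hminus) : set (H * H) :=
  part_in_H (bop_Re B).

Definition star_extension (T : set (H * H)) (B : bounded_op Hplus Hminus) :=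
  [/\ A `<=` T, T `<=` part_in_H B,
      A `<=` adjoint T, adjoint T `<=` part_in_H (bop_adj B)
    & A `<=` quasi_kernel B /\ self_adjoint (quasi_kernel B)].

Record Lsystem := MkLsystem {
  main_op : set (H * H) ;
  state_op : bounded_op Hplus Hminus ;
  channel_op : bounded_op R[i]^o Hminus ;
  main_op_operator : is_operator main_op ;
  main_op_ext : A `<=` main_op /\ main_op `<=` adjoint A ;
  main_op_dissipative : dissipative main_op ;
  state_op_star_extension : star_extension main_op state_op ;
  Lsystem_channel : forall f,
    bop_Im state_op f = channel_op (channel_adj channel_op f) }.

(* (B - z I)^-1 phi, with the value 0 if phi is not in the range of B - z I. *)
Definition resolvent (B : Hplus -> Hminus) (z : R[i]) (phi : Hminus) : Hplus :=
  xget 0 [set f | B f - z *: emb f = phi].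

(* Operators on the one-dimensional space C are identified with scalars. *)
Definition transfer_function (Th : Lsystem) (z : R[i]) : R[i] :=
  1 - 2 * ii *
    channel_adj (channel_op Th) (resolvent (state_op Th) z (channel_op Th 1)).

Definition impedance_function (Th : Lsystem) (z : R[i]) : R[i] :=
  channel_adj (channel_op Th)
    (resolvent (bop_Re (state_op Th)) z (channel_op Th 1)).

Definition perturbation (Q : R) (Th ThQ : Lsystem) : Prop :=
  forall z, complex.Im z != 0 ->
    impedance_function ThQ z = Q%:C + impedance_function Th z.

Definition c_entropy (Th : Lsystem) : \bar R :=
  (- lne (complex.Re `|transfer_function Th (- ii)|)%:E)%E.

End Rigged.

(* Main.v *)
(* Write A for the state operator and k for K^*.  The c-entropy of the perturbed
   system follows from V(-i) = Q - i through W = (1 - iV) / (1 + iV), so the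
   point is that V_Theta(-i) = -i.  If g_+ is in Dom T, then A g_+ = i g_+; the
   self-adjointness of the quasi-kernel puts g_- in Dom T^*, so
   A^* g_- = -i g_-, that is (Re A + i) g_- = i K (k g_-).  Since k g_- is
   nonzero, this exhibits (Re A + i)^-1 K = g_- / (i k g_-), whose image under
   k is -i. *)
Require Import Defs.
From mathcomp Require Import all_boot all_order all_algebra.
From mathcomp Require Import all_classical all_reals all_analysis.
From mathcomp Require Import complex ring.
Import Order.TTheory GRing.Theory Num.Theory.
Import numFieldNormedType.Exports.
Local Open Scope classical_set_scope.
Local Open Scope complex_scope.
Local Open Scope ring_scope.

(** * Identities for the imaginary unit and for functionals *)

Lemma conjC_i (R : realType) : ('i%C : R[i])^* = - 'i%C.
Proof. by apply/eqP; rewrite eq_complex /= oppr0 !eqxx. Qed.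

Lemma i_neq0 (R : realType) : ('i%C : R[i]) != 0.
Proof. by rewrite eq_complex /= oner_eq0 andbF. Qed.

Lemma double_i_neq0 (R : realType) : (2 * 'i%C : R[i]) != 0.
Proof. by rewrite mulf_neq0 ?i_neq0// pnatr_eq0. Qed.

Lemma subC_conj (R : realType) (z : R[i]) :
  z - z^* = 2 * 'i%C * (complex.Im z)%:C.
Proof.
by apply/eqP; rewrite eq_complex; case: z => a b /=; apply/andP; split;
  apply/eqP; ring.
Qed.

Lemma antidual_subE (R : realType) (E : normedModType R[i])
    (phi psi : antidual E) f : (phi - psi) f = phi f - psi f.
Proof. by []. Qed.

(** * The sesquilinear forms of the state operator and of its real part *)

Section LsystemTheory.
Context {R : realType} {H : hilbertType R} {A : closed_symmetric H}.
Variable Th : Lsystem A.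
Implicit Types (f g : Hplus A) (z : R[i]).
Local Notation B := (state_op Th).
Local Notation K := (channel_op Th).
Local Notation k := (channel_adj (channel_op Th)).

Lemma state_sub_adj f g : B f g - (B g f)^* = 2 * 'i%C * (k f * (k g)^*).
Proof.
have /(congr1 (fun phi : Hminus A => phi g)) := Lsystem_channel Th f.
rewrite channel_adjP /bop_Im antidual_scaleE => <-.
by rewrite mulrA divff ?mul1r// double_i_neq0.
Qed.

(** [Re B = B - i Im B] with [Im B = K k] eliminates the adjoint of [B]. *)
Lemma bop_ReE f g : bop_Re B f g = B f g - 'i%C * (k f * (k g)^*).
Proof.
rewrite /bop_Re antidual_scaleE antidual_addE /= /bop_adj_form.
have -> : (B g f)^* = B f g - 2 * 'i%C * (k f * (k g)^*).
  by rewrite -state_sub_adj; ring.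
have two : (2 : R[i]) != 0 by rewrite pnatr_eq0.
by apply: (mulfI two); rewrite mulrA divff// mul1r; ring.
Qed.

Lemma bop_Re_hermitian f g : bop_Re B f g = (bop_Re B g f)^*.
Proof.
rewrite !bop_ReE rmorphB !rmorphM /= conjCK conjC_i.
have -> : (B g f)^* = B f g - 2 * 'i%C * (k f * (k g)^*).
  by rewrite -state_sub_adj; ring.
ring.
Qed.

Lemma bop_ReB f g h : bop_Re B (f - g) h = bop_Re B f h - bop_Re B g h.
Proof. by rewrite !bop_ReE (linearB B) (linearB k) antidual_subE; ring. Qed.

Lemma channelZ (a : R[i]) f : k (a *: f) = a * k f.
Proof. by rewrite (linearZ_LR k). Qed.

Lemma bop_ReZ (a : R[i]) f h : bop_Re B (a *: f) h = a * bop_Re B f h.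
Proof.
by rewrite !bop_ReE (linearZ_LR B) channelZ (antidual_scaleE a); ring.
Qed.

Lemma embB f g h : emb A ((f - g : Hplus A) : H) h = emb A f h - emb A g h.
Proof. by rewrite /= /emb_fun dotBl. Qed.

(** * Injectivity off the real axis and values of the resolvents *)

Lemma Hplus_eq0 f : dotp (f : H) (f : H) = 0 -> f = 0.
Proof.
move/eqP; rewrite dotpxx expf_eq0 normr_eq0 /= => /eqP f0.
exact: val_inj.
Qed.

Lemma dotp_conj_self (x : H) : (dotp x x)^* = dotp x x.
Proof. by rewrite -dotC. Qed.

(** The form of [Re B] is Hermitian, so its diagonal is real and the imaginary part of the right
    side vanishes. *)
Lemma bop_Re_ker z f : complex.Im z != 0 ->
  bop_Re B f f = z * dotp (f : H) (f : H) -> f = 0.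
Proof.
move=> z0 e; apply: Hplus_eq0.
have := bop_Re_hermitian f f; rewrite e rmorphM /= dotp_conj_self => /eqP.
rewrite -subr_eq0 -mulrBl subC_conj !mulf_eq0 pnatr_eq0 (negbTE (i_neq0 _)) /=.
by rewrite eq_complex /= (negbTE z0) /= => /eqP.
Qed.

(** The imaginary part of [B f f] is [|k f|^2], which is nonnegative, while [Im z < 0] makes that of
    the right side nonpositive. *)
Lemma state_ker z f : complex.Im z < 0 ->
  B f f = z * dotp (f : H) (f : H) -> f = 0.
Proof.
move=> z0 e; apply: Hplus_eq0.
have := state_sub_adj f f; rewrite e rmorphM /= dotp_conj_self -mulrBl subC_conj.
rewrite -(mulrA (2 * 'i%C)) => /(mulfI (double_i_neq0 R)); rewrite -normCK => e2.
apply/eqP; rewrite eq_le dnorm_ge0 andbT.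
have : 0 <= (complex.Im z)%:C * dotp (f : H) (f : H) by rewrite e2 exprn_ge0.
by rewrite nmulr_rge0// ltcR.
Qed.

(** By [bop_Re_ker] the equation has at most one solution, so any solution is the one selected by
    [xget]. *)
Lemma impedanceE z f : complex.Im z != 0 ->
  bop_Re B f - z *: emb A f = K 1 -> impedance_function Th z = k f.
Proof.
move=> z0 fK; congr (k _); apply: xget_unique => //= g gK.
apply/eqP; rewrite -subr_eq0; apply/eqP; apply: (bop_Re_ker _ _ z0).
have := congr1 (fun phi : Hminus A => phi (g - f)) (etrans gK (esym fK)).
rewrite antidual_subE [RHS]antidual_subE
  (antidual_scaleE z (emb A g)) (antidual_scaleE z (emb A f)) => e.
rewrite -[LHS]/(bop_Re B (g - f) (g - f)) bop_ReB.
rewrite -[dotp _ _]/(emb A ((g - f : Hplus A) : H) (g - f)) embB.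
by move/eqP: e; rewrite subr_eq => /eqP ->; ring.
Qed.

(** The default value 0 of the resolvent would give impedance 0. *)
Lemma impedance_neq0 z : impedance_function Th z != 0 ->
  exists2 f, bop_Re B f - z *: emb A f = K 1 & impedance_function Th z = k f.
Proof.
rewrite /impedance_function /resolvent; case: xgetP => [f _ fK _|_].
  by exists f.
by rewrite linear0 eqxx.
Qed.

(** Uniqueness now comes from [state_ker], hence the restriction to the lower half-plane. *)
Lemma transferE z f : complex.Im z < 0 ->
  B f - z *: emb A f = K 1 -> transfer_function Th z = 1 - 2 * 'i%C * k f.
Proof.
move=> z0 fK; congr (_ - _ * k _); apply: xget_unique => //= g gK.
apply/eqP; rewrite -subr_eq0; apply/eqP; apply: (state_ker _ _ z0).
have := congr1 (fun phi : Hminus A => phi (g - f)) (etrans gK (esym fK)).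
rewrite antidual_subE [RHS]antidual_subE
  (antidual_scaleE z (emb A g)) (antidual_scaleE z (emb A f)) => e.
rewrite linearB.
rewrite -[dotp _ _]/(emb A ((g - f : Hplus A) : H) (g - f)) embB antidual_subE.
by move/eqP: e; rewrite subr_eq => /eqP ->; ring.
Qed.

(* The nonvanishing of V(z) ensures that the resolvent of the real part is not
   the junk value 0. *)
Lemma transfer_impedance z (v := impedance_function Th z) :
  complex.Im z < 0 -> v != 0 -> 1 + 'i%C * v != 0 ->
  transfer_function Th z = (1 - 'i%C * v) / (1 + 'i%C * v).
Proof.
move=> z0 v0 w0; have [g gK vE] := impedance_neq0 _ v0; rewrite -/v in vE.
(* As [B = Re B + i K k], applying [B - z] to [g] gives [(1 + i v) K 1]; this fixes the scaling of
   [g]. *)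
rewrite (transferE z ((1 + 'i%C * v)^-1 *: g))//.
  rewrite channelZ -vE.
  apply: (mulIf w0); rewrite divfK//.
  transitivity (1 + 'i%C * v - 2 * 'i%C * v * ((1 + 'i%C * v)^-1 * (1 + 'i%C * v))).
    by ring.
  by rewrite mulVf//; ring.
apply: antidual_eq => h.
have := congr1 (fun phi : Hminus A => phi h) gK.
rewrite !antidual_subE !(antidual_scaleE z) (linearZ_LR B) (antidual_scaleE _ (B g)).
rewrite -[emb A (_ *: _) h]/(dotp ((1 + 'i%C * v)^-1 *: (g : H)) (h : H)) dotZl.
rewrite -[emb A g h]/(dotp (g : H) (h : H)).
rewrite bop_ReE -vE channel_adjP mul1r => e.
have -> : B g h = (1 + 'i%C * v) * (k h)^* + z * dotp (g : H) (h : H).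
  by move/eqP: e; rewrite !subr_eq => /eqP ->; ring.
rewrite mulrDr mulrA mulVf// mul1r.
by ring.
Qed.

(** * Operators in [H] contained in the state operator *)

Lemma part_in_HP (S : Hplus A -> Hminus A) f (h : H) :
  part_in_H S (f : H, h) -> S f = emb A h.
Proof. by move=> [g /= gf <-]; congr (S _); apply: val_inj. Qed.

(** Adjoints reverse inclusions, and the quasi-kernel is a self-adjoint extension of [A]. *)
Lemma quasi_kernel_sub_adjoint : quasi_kernel B `<=` adjoint A.
Proof.
have [_ _ _ _ [AQ QQ]] := state_op_star_extension Th.
by move=> p; rewrite -{1}QQ => Qp q /AQ; exact: Qp.
Qed.

(** * Von Neumann parameter zero; the scalar [s] covers both sign cases at once *)

Section ZeroVonNeumannParameter.
Variables (gp gm : Hplus A) (s : R[i]).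
Hypothesis gp_def : deficiency_space A 'i%C (gp : H).
Hypothesis gm_def : deficiency_space A (- 'i%C) (gm : H).
Hypothesis gp0 : gp != 0.
Hypothesis s0 : s != 0.
Hypothesis gp_main : dom (main_op Th) (gp : H).
Hypothesis gps_qk : dom (quasi_kernel B) ((gp : H) + s *: (gm : H)).

Lemma main_gp : main_op Th (gp : H, 'i%C *: (gp : H)).
Proof.
have [h Th_h] := gp_main.
suff <- : h = 'i%C *: (gp : H) by [].
apply: (adjoint_functional _ gp_def).
by apply: (main_op_ext Th).2.
Qed.

Lemma state_gp f : B gp f = 'i%C * dotp (gp : H) (f : H).
Proof.
have [_ TB _ _ _] := state_op_star_extension Th.
by rewrite (part_in_HP _ _ _ (TB _ main_gp)) /= /emb_fun dotZl.
Qed.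

Lemma quasi_kernel_gps :
  quasi_kernel B ((gp : H) + s *: (gm : H),
                  'i%C *: (gp : H) - ('i%C * s) *: (gm : H)).
Proof.
have [h Qh] := gps_qk.
suff <- : h = 'i%C *: (gp : H) - ('i%C * s) *: (gm : H) by [].
apply: (adjoint_functional (quasi_kernel_sub_adjoint _ Qh)).
have := adjoint_linear s gm_def gp_def.
rewrite /= -[_ + _]/((_ + _, _ + _)) /= scalerA.
by rewrite addrC [X in (_, X)]addrC mulrN scaleNr mulrC.
Qed.

(** The imaginary part of [B gp gp] is both [|k gp|^2] and the squared norm of [gp] in [H]. *)
Lemma channel_gp_neq0 : k gp != 0.
Proof.
apply: contra gp0 => /eqP kg.
have := state_sub_adj gp gp; rewrite kg mul0r mulr0 state_gp.
rewrite rmorphM /= dotp_conj_self conjC_i => e; apply/eqP/Hplus_eq0.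
by apply: (mulfI (double_i_neq0 R)); rewrite mulr0 -e; ring.
Qed.

(** Each pair in [main_op Th] is a multiple of [(gp, i gp)] plus a pair in the quasi-kernel; the
    latter is tested against [gp + s gm]. *)
Lemma adjoint_main_gm : adjoint (main_op Th) (gm : H, - 'i%C *: (gm : H)).
Proof.
move=> [f0 h0] Tf /=.
have [_ TB _ _ [_ QQ]] := state_op_star_extension Th.
have [f ff Bf] := TB _ Tf; rewrite /= in ff Bf.
(* The component of f along gp is chosen so that the remainder f' is killed by
   k; then A f' = Re A f' and f' is in the domain of the quasi-kernel. *)
pose c := k f / k gp; pose f' := f - c *: gp.
pose h' := h0 - (c * 'i%C) *: (gp : H).
have Bf' g : B f' g = dotp h' (g : H).
  rewrite (linearB B) (linearZ_LR B) antidual_subE (antidual_scaleE c).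
  by rewrite state_gp Bf /= /emb_fun /h' dotBl dotZl mulrA.
have kf' : k f' = 0.
  rewrite (linearB k) channelZ divfK ?subrr//.
  exact: channel_gp_neq0.
have Qf' : quasi_kernel B (f' : H, h').
  exists f' => //=; apply: antidual_eq => g.
  by rewrite bop_ReE kf' mul0r mulr0 subr0 Bf'.
(* Because [k f' = 0], the form of [B] is Hermitian on [f'] and [gp]. *)
have gpE : dotp h' (gp : H) = - 'i%C * dotp (f' : H) (gp : H).
  have := state_sub_adj f' gp; rewrite kf' mul0r mulr0 Bf' state_gp => /eqP.
  by rewrite subr_eq0 => /eqP ->; rewrite rmorphM /= conjC_i -dotC.
(* Self-adjointness applied to [f'] and [gp + s gm]: the [gp] terms cancel by [gpE], leaving [s^*]
   times the relation for [gm]. *)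
have := quasi_kernel_gps; rewrite -{1}QQ => /(_ _ Qf') /=.
rewrite dotDr dotBr !dotZr gpE rmorphM /= conjC_i => e.
have gmE : dotp h' (gm : H) = 'i%C * dotp (f' : H) (gm : H).
  have cs0 : s^* != 0 by rewrite conjC_eq0.
  apply: (mulfI cs0); move/addrI: e => ->; ring.
have -> : h0 = h' + (c * 'i%C) *: (gp : H) by rewrite subrK.
have -> : f0 = (f' : H) + c *: (gp : H) by rewrite /f' -ff /= subrK.
rewrite (dotDl _ h') (dotDl _ (f' : H)) gmE !(dotZl _ _ (gp : H)) rmorphN /= conjC_i.
ring.
Qed.

Lemma bop_Re_gp f :
  bop_Re B gp f = 'i%C * dotp (gp : H) (f : H) - 'i%C * (k gp * (k f)^*).
Proof. by rewrite bop_ReE state_gp. Qed.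

(** Here [Re B] is the adjoint of [B] plus [i K k], and that adjoint multiplies [gm] by -i. *)
Lemma bop_Re_gm f :
  bop_Re B gm f = - 'i%C * dotp (gm : H) (f : H) + 'i%C * (k gm * (k f)^*).
Proof.
have [_ _ _ TB _] := state_op_star_extension Th.
have e : (B f gm)^* = - 'i%C * dotp (gm : H) (f : H).
  have := part_in_HP _ _ _ (TB _ adjoint_main_gm).
  by move=> /(congr1 (fun phi : Hminus A => phi f)); rewrite -dotZl.
rewrite bop_Re_hermitian bop_ReE rmorphB !rmorphM /= e conjC_i conjCK; ring.
Qed.

(** Comparing [Re B] on [gp + s gm] with the quasi-kernel leaves a multiple of [k gp - s * k gm];
    testing at [gp], where [k] is nonzero, kills it. This yields [k gm != 0]. *)
Lemma channel_gps : k gp = s * k gm.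
Proof.
have [g gE gQ] := quasi_kernel_gps.
have e : bop_Re B g gp =
    dotp ('i%C *: (gp : H) - ('i%C * s) *: (gm : H)) (gp : H).
  by have := congr1 (fun phi : Hminus A => phi gp) gQ.
have {gQ} {}gE : g = gp - (- s) *: gm.
  by apply: val_inj; rewrite scaleNr opprK.
move: e; rewrite gE bop_ReB bop_ReZ bop_Re_gp bop_Re_gm dotBl !dotZl => e.
have kc : 'i%C * (k gp)^* != 0.
  by rewrite mulf_neq0 ?i_neq0// conjC_eq0 channel_gp_neq0.
apply/eqP; rewrite -subr_eq0; apply/eqP; apply: (mulfI kc); rewrite mulr0.
apply: oppr_inj; rewrite oppr0.
by move/eqP: e; rewrite -subr_eq0 => /eqP e; rewrite -[RHS]e; ring.
Qed.

Lemma impedance_Ni : impedance_function Th (- 'i%C) = - 'i%C.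
Proof.
have km : k gm != 0.
  by move: channel_gp_neq0; rewrite channel_gps mulf_eq0 negb_or => /andP[].
have w0 : 'i%C * k gm != 0 by rewrite mulf_neq0 ?i_neq0.
have im : complex.Im (- 'i%C : R[i]) != 0 by rewrite /= oppr_eq0 oner_eq0.
rewrite (impedanceE _ (('i%C * k gm)^-1 *: gm) im).
  rewrite channelZ.
  apply: (mulfI w0); rewrite mulrA divff// mul1r.
  have i2 := sqr_i R; ring: i2.
apply: antidual_eq => h.
rewrite antidual_subE (antidual_scaleE (- 'i%C)).
rewrite -[emb A (_ *: _) h]/(dotp (('i%C * k gm)^-1 *: (gm : H)) (h : H)) dotZl.
rewrite bop_ReZ bop_Re_gm channel_adjP mul1r.
apply: (mulfI w0).
transitivity (('i%C * k gm) * ('i%C * k gm)^-1 * ('i%C * k gm * (k h)^*)).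
  by ring.
by rewrite divff// mul1r.
Qed.

End ZeroVonNeumannParameter.

End LsystemTheory.

(** * The modulus of the transfer function at -i and the c-entropy *)

Lemma norm_perturbed_transfer (R : realType) (Q : R) (v : R[i]) :
  v = Q%:C - 'i%C ->
  complex.Re `|(1 - 'i%C * v) / (1 + 'i%C * v)| =
  `|Q| / Num.sqrt (Q ^+ 2 + 4).
Proof.
move=> ->; rewrite normrM normfV.
have -> : 1 - 'i%C * (Q%:C - 'i%C) = 0 +i* (- Q).
  by apply/eqP; rewrite eq_complex /=; apply/andP; split; apply/eqP; ring.
have -> : 1 + 'i%C * (Q%:C - 'i%C) = 2 +i* Q.
  by apply/eqP; rewrite eq_complex /=; apply/andP; split; apply/eqP; ring.
rewrite !normc_def -fmorphV -rmorphM /= expr0n /= add0r sqrrN sqrtr_sqr.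
by congr (_ / Num.sqrt _); ring.
Qed.

Theorem theorem6 (R : realType) (H : hilbertType R) (A : closed_symmetric H)
    (hA : deficiency_indices_1_1 A)
    (gp gm : Hplus A)
    (hgp : deficiency_space A 'i%C (gp : H)) (ngp : `|gp| = 1)
    (hgm : deficiency_space A (- 'i%C) (gm : H)) (ngm : `|gm| = 1)
    (Th : Lsystem A)
    (hmax : maximal_dissipative (main_op Th))
    (hT : main_op Th <> adjoint (main_op Th))
    (hkappa : dom (main_op Th) (gp : H))
    (hqk : dom (quasi_kernel (state_op Th)) ((gp : H) - (gm : H)) \/
           dom (quasi_kernel (state_op Th)) ((gp : H) + (gm : H)))
    (Q : R) (hQ : Q != 0) (ThQ : Lsystem A) (hThQ : perturbation Q Th ThQ) :
  c_entropy ThQ \is a fin_num /\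
  c_entropy ThQ = (ln (Q ^+ 2 + 4) / 2 - ln `|Q|)%:E.
Proof.
have gp0 : gp != 0 by rewrite -normr_eq0 ngp oner_eq0.
have VTh : impedance_function Th (- 'i%C) = - 'i%C.
  (* The two alternatives are [s = -1] and [s = 1]. *)
  case: hqk => qk.
    apply: (impedance_Ni Th gp gm (-1)) ; rewrite ?oppr_eq0 ?oner_eq0//.
    by rewrite scaleN1r.
  apply: (impedance_Ni Th gp gm 1) ; rewrite ?oner_eq0//.
  by rewrite scale1r.
have VQ : impedance_function ThQ (- 'i%C) = Q%:C - 'i%C.
  by rewrite hThQ ?VTh//= oppr_eq0 oner_eq0.
have Q4 : 0 < Q ^+ 2 + 4 by rewrite ltr_wpDl ?sqr_ge0.
have sQ4 : 0 < Num.sqrt (Q ^+ 2 + 4) by rewrite sqrtr_gt0.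
have absQ : 0 < `|Q| by rewrite normr_gt0.
suff entropyE : c_entropy ThQ = (ln (Q ^+ 2 + 4) / 2 - ln `|Q|)%:E.
  by rewrite entropyE.
(* With [v = Q - i], both [v] and [1 + i v] have a coordinate equal to [Q], hence are nonzero. *)
rewrite /c_entropy transfer_impedance ?VQ; first last.
- by rewrite eq_complex /= negb_and; apply/orP; right;
    rewrite !(mul0r, mul1r, add0r, addr0, subr0).
- by rewrite eq_complex /= subr0 negb_and hQ.
- by rewrite /= oppr_lt0 ltr01.
rewrite (norm_perturbed_transfer _ Q) // lne_EFin ?divr_gt0// ln_div ?posrE//.
have -> : ln (Q ^+ 2 + 4) = ln (Num.sqrt (Q ^+ 2 + 4)) *+ 2.
  by rewrite -lnXn// sqr_sqrtr// ltW.
by rewrite -EFinN opprB -[_ *+ 2]mulr_natr mulfK// pnatr_eq0.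
Qed.
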